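(* For all integers $n,s\ge1$, $$\#\{\alpha\in\mathcal C_n:S(\alpha)=s\}=\sum_{d\mid s}\bigl(t_{n-s}-t_{n-s-d}\bigr).$$ In particular, if $n>2s$, then $$\mathbb P(S_n=s)=\mathbb P(S=s).$$
   Context: $\mathcal C_n$ is the set of integer compositions of $n$, i.e. ordered sequences $\alpha=(a_1,\ldots,a_\ell)$ of integers $a_i\ge1$ with sum $n$. The initial run of $\alpha$ is the maximal prefix $(a_1,\ldots,a_k)$ whose entries are all equal; $P(\alpha)=a_1$, $K(\alpha)=k$ is the number of parts in it, and $S(\alpha)=P(\alpha)K(\alpha)$. For an integer $m$, $t_m=0$ if $m<0$, $t_0=1$, and $t_m=2^{m-1}$ if $m\ge1$. For each $n\ge1$, $\alpha_n$ is uniformly distributed on $\mathcal C_n$, $P_n=P(\alpha_n)$, $K_n=K(\alpha_n)$, $S_n=S(\alpha_n)$. The pair $(P,K)$ of positive-integer random variables has the limiting joint law $\mathbb P(P=p,K=k)=\lim_{n\to\infty}\mathbb P(P_n=p,K_n=k)$ for $p,k\ge1$ (these pointwise limits exist and form a probability distribution), and $S=PK$. Sums over $d\mid s$ are over positive divisors. *)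

(* Defs.v *)
From HB Require Import structures.
From mathcomp Require Import all_boot all_order all_algebra.
From mathcomp Require Import all_classical all_reals all_analysis.

Set Implicit Arguments.
Unset Strict Implicit.
Unset Printing Implicit Defensive.

Import Order.TTheory GRing.Theory Num.Theory.
Import numFieldNormedType.Exports.

Local Open Scope ring_scope.

Definition is_composition (n : nat) : pred (seq nat) :=
  fun a => all (leq 1) a && (sumn a == n).

Record composition (n : nat) := Composition {
  parts :> seq nat;
  compositionP : is_composition n parts
}.

HB.instance Definition _ n := [isSub for @parts n].
HB.instance Definition _ n := [Countable of composition n by <:].

(* A composition of n has at most n parts, each at most n, so compositions
   embed in the finite type of such bounded sequences. *)
Definition composition_encode n (a : composition n) : n.-bseq 'I_n.+1 :=
  insub_bseq n [seq inord i | i <- parts a].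

Definition composition_decode n (b : n.-bseq 'I_n.+1) : option (composition n) :=
  insub [seq val i | i <- b].

Lemma composition_encodeK n :
  pcancel (@composition_encode n) (@composition_decode n).
Proof.
move=> a; rewrite /composition_decode /composition_encode.
have /andP[apos /eqP asum] := compositionP a.
have le_size (t : seq nat) : all (leq 1) t -> (size t <= sumn t)%N.
  elim: t => //= x t IHt /andP[x_gt0 /IHt le_t]; rewrite -add1n; exact: leq_add.
have le_sum (t : seq nat) x : x \in t -> (x <= sumn t)%N.
  elim: t => //= y t IHt; rewrite inE => /orP[/eqP-> | /IHt le_x].
    exact: leq_addr.
  exact: leq_trans le_x (leq_addl _ _).
have le_n : (size (parts a) <= n)%N
  by exact: leq_trans (le_size _ apos) (eq_leq asum).
rewrite /insub_bseq val_insubd size_map le_n.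
rewrite -map_comp.
rewrite (_ : map _ _ = parts a) ?valK //.
rewrite -[RHS]map_id; apply/eq_in_map => x /le_sum le_x /=.
by rewrite inordK // ltnS (leq_trans le_x) // asum.
Qed.

HB.instance Definition _ n : fintype.isFinite (composition n) :=
  PCanIsFinite (@composition_encodeK n).

(* P(a), the common value of the entries of the initial run. *)
Definition run_value (a : seq nat) : nat := head 0%N a.

(* K(a): the length of the maximal prefix whose entries are all equal. *)
Definition run_length (a : seq nat) : nat :=
  (\max_(k < (size a).+1 | constant (take k a)) k)%N.

(* S(a). *)
Definition run_sum (a : seq nat) : nat := (run_value a * run_length a)%N.

Definition t_ (m : int) : int :=
  match m with
  | Posz 0 => 1
  | Posz k.+1 => 2 ^+ k
  | Negz _ => 0
  end.

(* Probability of the event E for a uniformly distributed composition of n. *)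
Definition comp_prob (R : realType) (n : nat) (E : pred (seq nat)) : R :=
  #|[pred a : composition n | E a]|%:R / #|{: composition n}|%:R.

Definition limit_law (R : realType) (p k : nat) : R :=
  limn (fun n =>
    comp_prob R n (fun a => (run_value a == p) && (run_length a == k))).

Definition has_limit_law (R : realType) (disp : measure_display)
    (Omega : measurableType disp) (Pr : probability Omega R)
    (P K : {RV Pr >-> nat}) : Prop :=
  (forall w, (0 < P w)%N /\ (0 < K w)%N) /\
  (forall p k : nat, (0 < p)%N -> (0 < k)%N ->
     Pr [set w | P w = p /\ K w = k]%classic = (limit_law R p k)%:E).

(* Main.v *)
Require Import Defs.
From HB Require Import structures.
From mathcomp Require Import all_boot all_order all_algebra.
From mathcomp Require Import all_classical all_reals all_analysis.
From mathcomp Require Import zify.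

(** For k > 0 a nonempty composition has initial value p and initial run of
    length at least k exactly when it begins with p repeated k times.
    Deleting that prefix identifies such compositions of n with all the
    compositions of n - pk, of which there are t_(n - pk).  Subtracting the
    same count for k + 1 gives t_(n - pk) - t_(n - pk - p) compositions with
    run value p and run length exactly k ([card_run]), and the first claim
    follows by splitting the event S = s according to the value d of P, which
    divides s and forces K = s / d ([card_run_sum]).

    When n > pk + p the two counts are genuine powers of 2, so their quotient
    by 2^(n-1) no longer depends on n ([comp_prob_run]).  The sequence defining
    the limiting law at (p, k) is therefore constant from there on, and equals
    its limit ([limit_lawE]).  For pk = s one has p <= s, so n > 2s puts every
    pair (d, s / d) in this stable range; summing over d gives the second
    claim. *)

Set Implicit Arguments.
Unset Strict Implicit.
Unset Printing Implicit Defensive.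

Import Order.TTheory GRing.Theory Num.Theory.
Import numFieldNormedType.Exports.

Local Open Scope ring_scope.

(** * Counting compositions by bijections *)

(** Maps between compositions are given on the underlying sequences, where
    they are simple list surgery; validity of the result is only required on
    the event considered.  The left inverse g makes f injective there. *)
Lemma leq_card_composition (m n : nat) (A B : pred (seq nat))
    (f g : seq nat -> seq nat) :
  (forall a, is_composition m a -> A a ->
     [/\ is_composition n (f a), B (f a) & g (f a) = a]) ->
  (#|[pred a : composition m | A a]| <= #|[pred a : composition n | B a]|)%N.
Proof.
move=> fAB.
pose image_of k (E : pred (seq nat)) :=
  [seq parts a | a <- enum [pred a : composition k | E a]].
have mem_image k (E : pred (seq nat)) b :
    reflect (is_composition k b /\ E b) (b \in image_of k E).
  apply: (iffP mapP) => [[a]|[compb Eb]].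
    by rewrite mem_enum inE => Ea ->; split=> //; exact: compositionP.
  by exists (Composition compb); rewrite // mem_enum inE.
have uniq_image k E : uniq (image_of k E).
  by rewrite map_inj_uniq ?enum_uniq //; exact: val_inj.
have size_image k E : size (image_of k E) = #|[pred a : composition k | E a]|.
  by rewrite size_map -cardE.
rewrite -!size_image -(size_map f); apply: uniq_leq_size.
  rewrite map_inj_in_uniq // => a b /mem_image[ca Aa] /mem_image[cb Ab] fab.
  by have [[_ _ <-] [_ _ <-]] := (fAB a ca Aa, fAB b cb Ab); rewrite fab.
move=> _ /mapP[a /mem_image[ca Aa] ->].
by have [cfa Bfa _] := fAB a ca Aa; apply/mem_image.
Qed.

Lemma eq_card_composition (m n : nat) (A B : pred (seq nat))
    (f g : seq nat -> seq nat) :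
  (forall a, is_composition m a -> A a ->
     [/\ is_composition n (f a), B (f a) & g (f a) = a]) ->
  (forall b, is_composition n b -> B b ->
     [/\ is_composition m (g b), A (g b) & f (g b) = b]) ->
  #|[pred a : composition m | A a]| = #|[pred a : composition n | B a]|.
Proof.
move=> fAB gBA; apply/eqP; rewrite eqn_leq.
by rewrite (leq_card_composition fAB) (leq_card_composition gBA).
Qed.

Lemma card_prefix (m p k : nat) : (0 < p)%N ->
  #|[pred a : composition (p * k + m) | take k a == nseq k p]| =
  #|{: composition m}|.
Proof.
move=> p_gt0.
rewrite -[RHS]/#|[pred a : composition m | predT (parts a)]|.
apply: (@eq_card_composition _ _ (fun a => take k a == nseq k p) predT
    (drop k) (cat (nseq k p))) => a.
  move=> compa /eqP takea.
  have aE : nseq k p ++ drop k a = a by rewrite -takea cat_take_drop.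
  move: compa; rewrite -{1}aE /is_composition all_cat sumn_cat sumn_nseq.
  by rewrite eqn_add2l => /andP[/andP[_ ->] ->].
move=> /andP[posa /eqP suma] _; rewrite drop_size_cat ?size_nseq //.
rewrite take_size_cat ?size_nseq // /is_composition all_cat sumn_cat.
by rewrite sumn_nseq suma eqxx posa all_nseq p_gt0 orbT.
Qed.

Lemma card_prefix_large (n p k : nat) : (n < p * k)%N ->
  #|[pred a : composition n | take k a == nseq k p]| = 0%N.
Proof.
move=> n_lt; apply: eq_card0 => a; rewrite !inE; apply/negP => /eqP takea.
have /andP[_ /eqP suma] := compositionP a.
have := sumn_cat (take k a) (drop k a).
by rewrite cat_take_drop takea sumn_nseq suma; lia.
Qed.

(** The compositions of n + 2 starting with 1 correspond to those of n + 1 by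
    dropping that 1, and the others by decrementing their first part. *)
Lemma card_compositionS (n : nat) :
  #|{: composition n.+2}| = (#|{: composition n.+1}| * 2)%N.
Proof.
rewrite -[LHS](cardC [pred a : composition n.+2 | take 1 a == nseq 1 1]).
rewrite muln2 -addnn; congr addn; first exact: (@card_prefix n.+1 1 1).
pose A (a : seq nat) := take 1 a != nseq 1 1.
rewrite -[LHS]/#|[pred a : composition n.+2 | A (parts a)]|.
rewrite -[RHS]/#|[pred a : composition n.+1 | predT (parts a)]|.
pose shift (h : nat -> nat) (a : seq nat) := h (head 0 a)%N :: behead a.
apply: (@eq_card_composition _ _ A predT (shift predn) (shift succn))
  => [] [|x a] //.
  rewrite /A /= take0 eqseq_cons andbT /is_composition /shift /=.
  move=> /andP[/andP[x_gt0 ->]] /eqP suma x_neq1.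
  by split=> //; [lia | rewrite prednK].
rewrite /A /= take0 eqseq_cons andbT /is_composition /shift /=.
by move=> /andP[/andP[x_gt0 ->]] /eqP suma _; split=> //; lia.
Qed.

Lemma card_composition (n : nat) : #|{: composition n}|%:Z = t_ n%:Z.
Proof.
have card0 : #|{: composition 0}| = 1%N.
  have comp0 : is_composition 0 [::] by [].
  rewrite (eq_card (B := pred1 (Composition comp0))) ?card1 // => -[a compa].
  rewrite !inE; apply/esym/eqP/val_inj => /=.
  by case: a compa => // x a /andP[/andP[]]; rewrite /= addn_eq0; case: x.
have card1' : #|{: composition 1}| = 1%N.
  have comp1 : is_composition 1 [:: 1%N] by [].
  rewrite (eq_card (B := pred1 (Composition comp1))) ?card1 // => -[a compa].
  rewrite !inE; apply/esym/eqP/val_inj => /=.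
  case: a compa => // x [|y a] /andP[/= /andP[x_gt0]].
    by rewrite addn0 => _ /eqP ->.
  by case/andP=> y_gt0 _ /eqP; lia.
case: n => [|n]; first by rewrite card0.
elim: n => [|n IHn]; first by rewrite card1'.
by rewrite card_compositionS PoszM IHn /= exprSr.
Qed.

(** The convention that t_ vanishes at negative integers is exactly what covers
    a prefix too heavy to fit in n. *)
Lemma card_prefixE (n p k : nat) : (0 < p)%N ->
  #|[pred a : composition n | take k a == nseq k p]|%:Z =
  t_ (n%:Z - (p * k)%:Z).
Proof.
move=> p_gt0; have [le_n|gt_n] := leqP (p * k) n.
  rewrite -(subnKC le_n) card_prefix // card_composition.
  by congr t_; rewrite PoszD [RHS]addrC addKr.
rewrite card_prefix_large //.
case E: (n%:Z - (p * k)%:Z) => [m|m] //; lia.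
Qed.

(** * The initial run *)

(** Being constant is inherited by shorter prefixes, so comparing j with the
    maximum defining the run length amounts to testing the prefix of length j
    alone.  The equation with nseq also records that j <= size a. *)
Lemma leq_run_length (a : seq nat) (j : nat) :
  (j <= run_length a)%N = (take j a == nseq j (run_value a)).
Proof.
have constantE (b : seq nat) : constant b = (b == nseq (size b) (head 0 b)%N).
  case: b => //= x b; rewrite eqseq_cons eqxx /=.
  by apply/all_pred1P/eqP.
have constant_takeE i : (i <= size a)%N ->
    constant (take i a) = (take i a == nseq i (run_value a)).
  move=> le_i; rewrite constantE size_takel //.
  by case: i le_i => [|i]; [rewrite take0 | case: a].
apply/idP/eqP => [|eq_j]; last first.
  have le_j : (j <= size a)%N.
    by move/(congr1 size): eq_j; rewrite size_take_min size_nseq => /minn_idPl.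
  rewrite -[j]/(nat_of_ord (Ordinal (le_j : (j < (size a).+1)%N))).
  by apply: leq_bigmax_cond => /=; rewrite constant_takeE // eq_j.
have [|i ci max_i] := @eq_bigmax_cond _
    [pred k : 'I_(size a).+1 | constant (take k a)] (@nat_of_ord _).
  by apply/card_gt0P; exists ord0; rewrite inE take0.
rewrite (_ : run_length a = i); last exact: max_i.
move=> le_ji; rewrite inE constant_takeE in ci; last by rewrite -ltnS.
by rewrite -(take_takel _ le_ji) (eqP ci) take_nseq.
Qed.

Lemma leq_run_length_value (a : seq nat) (p k : nat) : (0 < k)%N -> a != [::] ->
  (run_value a == p) && (k <= run_length a)%N = (take k a == nseq k p).
Proof.
move=> k_gt0 a_neq0; rewrite leq_run_length.
apply/andP/eqP => [[/eqP <- /eqP] // | eq_k].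
suff -> : run_value a = p by rewrite eq_k !eqxx.
by case: k k_gt0 eq_k => // k _; case: a a_neq0 => //= x a _ [].
Qed.

(** Run length exactly k means at least k but not at least k + 1, and both of
    the latter events are prefix events. *)
Lemma card_run (n p k : nat) : (0 < n)%N -> (0 < p)%N -> (0 < k)%N ->
  #|[pred a : composition n | (run_value a == p) && (run_length a == k)]|%:Z =
  t_ (n%:Z - (p * k)%:Z) - t_ (n%:Z - (p * k)%:Z - p%:Z).
Proof.
move=> n_gt0 p_gt0 k_gt0.
have prefixE j : (0 < j)%N ->
    #|[pred a : composition n | (run_value a == p) && (j <= run_length a)%N]|%:Z
    = t_ (n%:Z - (p * j)%:Z).
  move=> j_gt0; rewrite -card_prefixE //; congr Posz; apply: eq_card => a.
  rewrite !inE leq_run_length_value //.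
  apply/eqP => a0; have /andP[_] := compositionP a.
  by rewrite a0 /= => /eqP; lia.
have <- := prefixE k k_gt0.
have -> : n%:Z - (p * k)%:Z - p%:Z = n%:Z - (p * k.+1)%:Z by lia.
rewrite -prefixE //; apply/eqP; rewrite eq_sym subr_eq -PoszD; apply/eqP.
congr Posz; rewrite -[LHS](cardID
  [pred a : composition n | (run_length a == k)]).
congr addn; apply: eq_card => a; rewrite !inE.
  by case: (run_length a =P k) => [->|_]; rewrite ?leqnn ?andbT ?andbF.
by rewrite andbCA ltn_neqAle [k == _]eq_sym.
Qed.

(** A composition with S = s is counted once, at d equal to its run value. *)
Lemma card_run_sum (n s : nat) : (0 < s)%N ->
  #|[pred a : composition n | run_sum a == s]| =
  (\sum_(d <- divisors s) #|[pred a : composition n |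
     (run_value a == d) && (run_length a == (s %/ d))]|)%N.
Proof.
move=> s_gt0; rewrite -sum1_card big_mkcond /=.
under [RHS]eq_bigr => d _ do rewrite -sum1_card big_mkcond /=.
rewrite exchange_big /=; apply: eq_bigr => a _; rewrite !inE.
under eq_bigr => d _ do rewrite inE.
case: eqP => [sE|s_neq].
  rewrite (bigD1_seq (run_value a)) ?divisors_uniq //=; last first.
    by rewrite -dvdn_divisors // -sE dvdn_mulr.
  have v_gt0 : (0 < run_value a)%N.
    by move: s_gt0; rewrite -sE muln_gt0 => /andP[].
  rewrite eqxx -sE mulKn // eqxx big1 // => d.
  by rewrite eq_sym => /negbTE ->.
rewrite big_seq big1 // => d; rewrite -dvdn_divisors // => d_dvd.
case: andP => // -[/eqP vE /eqP lE]; case: s_neq.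
by rewrite /run_sum vE lE mulnC divnK.
Qed.

(** * The limiting law *)

(** The strict bound keeps n - i positive: for n = i > 0 the ratio is
    1 / 2^(n-1), since t_ 0 is 1 rather than 1/2. *)
Lemma t_ratio (R : realType) (n i : nat) : (i < n)%N ->
  (t_ (n%:Z - i%:Z))%:~R / (t_ n)%:~R = 2^-1 ^+ i :> R.
Proof.
move=> /subnKC <-; set m := (n - i.+1)%N.
have -> : (i.+1 + m)%N%:Z - i%:Z = m.+1%:Z by lia.
rewrite addSn /t_ !rmorphXn /= exprD invfM mulrCA divff ?mulr1 ?exprVn //.
Qed.

Lemma comp_prob_run (R : realType) (n p k : nat) :
  (0 < p)%N -> (0 < k)%N -> (p * k + p < n)%N ->
  comp_prob R n (fun a => (run_value a == p) && (run_length a == k)) =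
  2^-1 ^+ (p * k) - 2^-1 ^+ (p * k + p).
Proof.
move=> p_gt0 k_gt0 n_gt; have n_gt0 : (0 < n)%N by lia.
have natrE m (x : int) : m%:Z = x -> m%:R = x%:~R :> R by move=> <-.
rewrite /comp_prob (natrE _ _ (card_run n_gt0 p_gt0 k_gt0)).
rewrite (natrE _ _ (card_composition n)) rmorphB mulrBl t_ratio /=; last by lia.
by rewrite -[_ - _ - p%:Z]addrA -opprD -PoszD t_ratio.
Qed.

(** The probabilities are constant in n beyond pk + p, so each of them there is
    the limit. *)
Lemma limit_lawE (R : realType) (n p k : nat) :
  (0 < p)%N -> (0 < k)%N -> (p * k + p < n)%N ->
  limit_law R p k =
  comp_prob R n (fun a => (run_value a == p) && (run_length a == k)).
Proof.
move=> p_gt0 k_gt0 n_gt; apply: cvg_lim => //; rewrite comp_prob_run //.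
apply: cvg_near_cst; near=> m; apply: comp_prob_run => //.
by near: m; exact: nbhs_infty_gt.
Unshelve. all: by end_near. Qed.

(** The event PK = s is the disjoint union over d dividing s of the events
    P = d, K = s / d; s > 0 is what makes the family of pairs finite. *)
Lemma RV_prod_eq (R : realType) (disp : measure_display)
    (Omega : measurableType disp) (Pr : probability Omega R)
    (P K : {RV Pr >-> nat}) (s : nat) : (0 < s)%N ->
  Pr [set w | (P w * K w)%N = s]%classic =
  (\sum_(d <- divisors s)
     Pr [set w | P w = d /\ K w = (s %/ d)%N]%classic)%E.
Proof.
move=> s_gt0.
pose F d := [set w | P w = d /\ K w = (s %/ d)%N]%classic.
have F_meas d : measurable (F d).
  rewrite (_ : F d = (P @^-1` [set d] `&` K @^-1` [set (s %/ d)%N])%classic) //.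
  by apply: measurableI; exact: measurable_funPTI.
have -> : [set w | (P w * K w)%N = s]%classic =
    (\bigcup_(d in [set` divisors s]) F d)%classic.
  apply/seteqP; split=> [w /= PKs|w [d /= d_div [-> ->]]]; last first.
    by rewrite mulnC divnK // dvdn_divisors.
  exists (P w) => /=; first by rewrite -dvdn_divisors // -PKs dvdn_mulr.
  split=> //; rewrite -PKs mulKn //.
  by move: s_gt0; rewrite -PKs muln_gt0 => /andP[].
have F_triv : trivIset [set` divisors s]%classic F.
  by move=> d e _ _ [w [[<- _] [<- _]]].
rewrite measure_fin_bigcup //; last exact: finite_seq.
by rewrite -fsbig_seq ?divisors_uniq.
Qed.

Theorem proposition5p6 (n s : nat) (hn : (0 < n)%N) (hs : (0 < s)%N) :
  (#|[pred a : composition n | run_sum a == s]|%:Z =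
     \sum_(d <- divisors s) (t_ (n%:Z - s%:Z) - t_ (n%:Z - s%:Z - d%:Z))) /\
  ((2 * s < n)%N ->
   forall (R : realType) (disp : measure_display) (Omega : measurableType disp)
     (Pr : probability Omega R) (P K : {RV Pr >-> nat}),
   has_limit_law P K ->
   (comp_prob R n (fun a => run_sum a == s))%:E =
     Pr [set w | (P w * K w)%N = s]%classic).
Proof.
have div_gt0 d : d \in divisors s ->
    [/\ (0 < d)%N, (0 < s %/ d)%N, (d * (s %/ d) = s)%N & (d <= s)%N].
  rewrite -dvdn_divisors // => d_dvd; have d_gt0 := dvdn_gt0 hs d_dvd.
  have le_d := dvdn_leq hs d_dvd.
  by split=> //; rewrite ?divn_gt0 // mulnC divnK.
split=> [|n_gt R disp Omega Pr P K [_ PKlaw]].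
  rewrite card_run_sum // -[LHS]natz natr_sum.
  apply: eq_big_seq => d /div_gt0[d_gt0 q_gt0 dqE _].
  by rewrite natz card_run // dqE.
rewrite RV_prod_eq // /comp_prob card_run_sum // natr_sum mulr_suml -sumEFin.
apply: eq_big_seq => d /div_gt0[d_gt0 q_gt0 dqE le_d].
by rewrite PKlaw // (@limit_lawE _ n) // dqE; lia.
Qed.
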